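(* Let $(\mathcal{M},\varphi)$ be a tracial non-commutative probability space and let $\mathcal{A},\mathcal{B}\subseteq\mathcal{M}$ be unital subalgebras. Then $\mathcal{A}$ and $\mathcal{B}$ are free if and only if $\beta_n(a_1,a_2,\ldots,a_n)=0$ for every $n>1$ and all $a_1,\dots,a_n\in\mathcal{A}\cup\mathcal{B}$ such that $a_1$ and $a_n$ come from different subalgebras (i.e. $a_1\in\mathcal{A}$ and $a_n\in\mathcal{B}$, or $a_1\in\mathcal{B}$ and $a_n\in\mathcal{A}$).
   Context: A non-commutative probability space $(\mathcal{M},\varphi)$ is a unital $*$-algebra $\mathcal{M}$ over $\mathbb{C}$ with a positive unital linear functional $\varphi:\mathcal{M}\to\mathbb{C}$; it is tracial if $\varphi(ab)=\varphi(ba)$ for all $a,b\in\mathcal{M}$. Subalgebras $\mathcal{A},\mathcal{B}$ are free if $\varphi(u_1u_2\cdots u_n)=0$ whenever $n\ge 1$, $\varphi(u_j)=0$ for all $j$, each $u_j$ lies in $\mathcal{A}$ or in $\mathcal{B}$, and consecutive elements come from different subalgebras. The Boolean cumulants are the multilinear functionals $\beta_n:\mathcal{M}^n\to\mathbb{C}$, $n\ge1$, determined recursively by $$\varphi(a_1a_2\cdots a_n)=\sum_{k=1}^n\beta_k(a_1,\dots,a_k)\,\varphi(a_{k+1}\cdots a_n),$$ where the empty product is $1$. *)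

(* Defs.v *)
From HB Require Import structures.
From mathcomp Require Import all_boot all_order all_algebra.
From mathcomp Require Import complex.
From mathcomp Require Import reals.

Set Implicit Arguments.
Unset Strict Implicit.
Unset Printing Implicit Defensive.

Import Order.TTheory GRing.Theory Num.Theory.
Local Open Scope ring_scope.

(* In the order of R[i], 0 <= z means that z is real and nonnegative. *)
Record ncProbSpace (R : realType) := NCProbSpace {
  nc_alg :> algType R[i];
  star : nc_alg -> nc_alg;
  starK : involutive star;
  starD : {morph star : x y / x + y};
  starZ : forall (c : R[i]) x, star (c *: x) = conjc c *: star x;
  starM : forall x y, star (x * y) = star y * star x;
  phi : {scalar nc_alg};
  phi1 : phi 1 = 1;
  phi_ge0 : forall x, 0 <= phi (star x * x)
}.

Arguments star {R n} : rename.
Arguments phi {R n} : rename.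

Section NCProbability.
Variables (R : realType) (M : ncProbSpace R).

Definition tracial : Prop := forall a b : M, phi (a * b) = phi (b * a).

(* The colouring c records which subalgebra each factor is taken from: an
   element of the intersection may be given either colour, but only one
   within a given word. *)
Definition free_subalgebras (A B : {pred M}) : Prop :=
  forall (n : nat) (u : n.-tuple M) (c : nat -> bool),
    (0 < n)%N ->
    (forall j : 'I_n, phi (tnth u j) = 0) ->
    (forall j : 'I_n, tnth u j \in (if c j then A else B)) ->
    (forall j : nat, (j.+1 < n)%N -> c j != c j.+1) ->
    phi (\prod_(x <- u) x) = 0.

Definition moment (s : seq M) : R[i] := phi (\prod_(x <- s) x).

(* The moment recursion solved for its k = n term, with m bounding the
   recursion depth. *)
Fixpoint boolean_cumulant_rec (m : nat) (s : seq M) : R[i] :=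
  if m is m'.+1 then
    moment s - \sum_(1 <= k < size s)
                  boolean_cumulant_rec m' (take k s) * moment (drop k s)
  else 0.

(* beta_n (a_1, ..., a_n) is boolean_cumulant [:: a_1; ...; a_n]; the value 0
   at the empty sequence is a placeholder. *)
Definition boolean_cumulant (s : seq M) : R[i] :=
  boolean_cumulant_rec (size s) s.

Lemma boolean_cumulant_rec_stable m s :
  (0 < size s <= m)%N -> boolean_cumulant_rec m s = boolean_cumulant s.
Proof.
suff H m1 m2 (t : seq M) : (0 < size t)%N -> (size t <= m1)%N ->
    (size t <= m2)%N -> boolean_cumulant_rec m1 t = boolean_cumulant_rec m2 t.
  by case/andP=> s_gt0 le_sm; apply: H.
elim: m1 m2 t => [|m1 IH] [|m2] t t_gt0 t1 t2; try by case: (size t) t_gt0 t1 t2.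
congr (_ - _); apply: eq_big_nat => k /andP[k_gt0 lt_kt]; congr (_ * _).
by apply: IH; rewrite size_takel ?(ltnW lt_kt) // -ltnS (leq_trans lt_kt).
Qed.

Lemma boolean_cumulantE s : (0 < size s)%N ->
  moment s = \sum_(1 <= k < (size s).+1)
               boolean_cumulant (take k s) * moment (drop k s).
Proof.
move=> s_gt0; rewrite big_nat_recr //= take_size drop_size.
rewrite {3}/moment big_nil phi1 mulr1 {2}/boolean_cumulant.
case def_n: (size s) s_gt0 => [//|n] _ /=; rewrite def_n.
rewrite (eq_big_nat _ _
  (F2 := fun k => boolean_cumulant_rec n (take k s) * moment (drop k s))).
  by rewrite addrC subrK.
move=> k /andP[k_gt0 lt_kn]; rewrite boolean_cumulant_rec_stable //.
by rewrite size_takel ?def_n ?k_gt0 // ltnW.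
Qed.

Lemma boolean_cumulant_unique (b : seq M -> R[i]) :
  (forall s, (0 < size s)%N ->
     moment s = \sum_(1 <= k < (size s).+1) b (take k s) * moment (drop k s)) ->
  forall s, (0 < size s)%N -> b s = boolean_cumulant s.
Proof.
move=> bE s; have [m] := ubnP (size s); elim: m s => // m IH s le_sm s_gt0.
have := bE s s_gt0; rewrite (boolean_cumulantE s_gt0) !big_nat_recr //=.
rewrite !take_size drop_size /moment big_nil phi1 !mulr1.
rewrite (eq_big_nat _ _ (F2 := fun k => b (take k s) * moment (drop k s))).
  by move/addrI.
move=> k /andP[k_gt0 lt_ks]; rewrite IH // size_takel ?(ltnW lt_ks) //.
exact: leq_trans lt_ks _.
Qed.

Lemma moment_multilinear s1 s2 (c : R[i]) x y :
  moment (s1 ++ (c *: x + y) :: s2) =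
    c * moment (s1 ++ x :: s2) + moment (s1 ++ y :: s2).
Proof.
rewrite /moment !big_cat !big_cons /= mulrDl mulrDr -scalerAl -scalerAr.
by rewrite linearP.
Qed.

Lemma boolean_cumulant_multilinear s1 s2 (c : R[i]) x y :
  boolean_cumulant (s1 ++ (c *: x + y) :: s2) =
    c * boolean_cumulant (s1 ++ x :: s2) + boolean_cumulant (s1 ++ y :: s2).
Proof.
have [m] := ubnP (size s2); elim: m s2 => // m IH s2 le_s2m.
pose w z := s1 ++ z :: s2; rewrite -!/(w _).
have sz z : size (w z) = (size s1 + size s2).+1.
  by rewrite size_cat /= addnS.
have bE z : boolean_cumulant (w z) = moment (w z) -
    \sum_(1 <= k < (size s1 + size s2).+1)
       boolean_cumulant (take k (w z)) * moment (drop k (w z)).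
  rewrite (@boolean_cumulantE (w z)) ?sz // big_nat_recr //= -(sz z).
  rewrite take_size drop_size [moment [::]]/moment big_nil phi1 mulr1.
  by rewrite addrAC subrr add0r.
rewrite !bE moment_multilinear mulrBr addrACA -opprD mulr_sumr -big_split /=.
congr (_ - _); apply: eq_big_nat => k /andP[_ lt_k]; rewrite /w.
rewrite !take_cat !drop_cat; case: ltnP => [lt_k1|le_1k].
  by rewrite moment_multilinear mulrDr mulrCA.
case def_j: (k - size s1)%N => [|j] /=.
  by rewrite (moment_multilinear [::]) mulrDr mulrCA.
rewrite IH ?mulrDl ?mulrA // size_take_min.
apply: (@leq_ltn_trans j); first exact: geq_minl.
rewrite -ltnS -def_j ltnS leq_subLR.
by apply: (@leq_trans (size s1 + size s2)); rewrite ?leq_add2l.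
Qed.

End NCProbability.

(* Main.v *)
Require Import Defs.
From HB Require Import structures.
From mathcomp Require Import all_boot all_order all_algebra.
From mathcomp Require Import complex.
From mathcomp Require Import reals.

Import Order.TTheory GRing.Theory Num.Theory.
Local Open Scope ring_scope.

(** Write [Q x = x - phi x], so that
    [beta_n (a_1, ..., a_n) = phi (a_1 Q (a_2 Q ( ... Q a_n)))].  If A and B
    are free, left multiplication by an element of A or B followed by [Q]
    preserves the span of the alternating centered words ending in a given
    subalgebra, and [phi (a v) = 0] for [v] in this span and [a] in the other
    subalgebra.  Conversely, for an alternating centered word whose end letters
    lie in different subalgebras, every term of the moment-cumulant recursion
    vanishes, by induction on the length or by the hypothesis on beta; if the
    end letters lie in the same subalgebra, traciality merges them and shortens
    the word. *)

Section BooleanCumulantFormula.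
Context {R : realType} {M : ncProbSpace R}.
Implicit Types (a x : M) (s : seq M).

Definition center x : M := x - phi x *: 1.

Lemma center_linear : linear center.
Proof.
move=> c x y; rewrite /center linearP scalerDl opprD addrACA scalerBr.
by rewrite scalerA.
Qed.

HB.instance Definition _ :=
  GRing.isLinear.Build R[i] M M *:%R center center_linear.

Lemma phi_center x : phi (center x) = 0.
Proof. by rewrite /center linearB linearZ /= phi1 mulr1 subrr. Qed.

Lemma centerK x : center x + phi x *: 1 = x.
Proof. by rewrite /center subrK. Qed.

Lemma phi_mull_center x a :
  phi (x * a) = phi (center x * a) + phi x * phi a.
Proof.
by rewrite -{1}(centerK x) mulrDl -scalerAl mul1r linearD linearZ.
Qed.

(** With base value 1, the empty fold accounts for the first cumulant, which is [phi]. *)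
Definition centered_fold s : M := foldr (fun a x => center (a * x)) 1 s.

(** The mean of the whole product is the term [k = 0]; its center gives the other terms, by
    expanding the tail and using linearity of [center]. *)
Lemma prod_centered_fold s :
  \prod_(x <- s) x =
    \sum_(0 <= k < (size s).+1)
       moment (drop k s) *: centered_fold (take k s).
Proof.
elim: s => [|a s IH]; first by rewrite big_nat1 /moment !big_nil phi1 scale1r.
rewrite big_nat_recl //= -[LHS]centerK addrC; congr (_ + _).
rewrite big_cons IH mulr_sumr linear_sum /=.
by apply: eq_bigr => k _; rewrite -scalerAr linearZ.
Qed.

(** Applying [phi (a * _)] to the expansion of the tail's product gives the moment recursion, which
    determines the cumulants. *)
Lemma boolean_cumulant_cons a s :
  boolean_cumulant (a :: s) = phi (a * centered_fold s).
Proof.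
pose b t := if t is x :: t' then phi (x * centered_fold t') else 0 : R[i].
rewrite -(@boolean_cumulant_unique R M b) // => -[//|x t] _.
rewrite big_add1 /= /moment big_cons {1}prod_centered_fold mulr_sumr linear_sum.
by apply: eq_bigr => k _; rewrite -scalerAr linearZ /= mulrC.
Qed.

End BooleanCumulantFormula.

Section Freeness.
Context {R : realType} {M : ncProbSpace R} (A B : {pred M}).
Hypotheses (algA : GRing.subalg_closed A) (algB : GRing.subalg_closed B).
Implicit Types (a x v : M) (u s : seq M) (c d e : bool).

Let S c : {pred M} := if c then A else B.

(** An alternating colouring is determined by the colour [c] of its first letter; [true] stands for
    [A]. *)
Fixpoint alternating_centered c u : bool :=
  if u is x :: u' then
    [&& x \in S c, phi x == 0 & alternating_centered (~~ c) u']
  else true.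

Lemma alternating_centered_cat c u s :
  alternating_centered c (u ++ s) =
    alternating_centered c u && alternating_centered (c (+) odd (size u)) s.
Proof.
elim: u c => [|x u IH] c /=; first by rewrite addbF.
by rewrite IH -!andbA addNb addbN.
Qed.

Lemma alternating_centered_nthP c u :
  reflect (forall i, (i < size u)%N ->
             u`_i \in S (c (+) odd i) /\ phi u`_i = 0)
          (alternating_centered c u).
Proof.
elim: u c => [|x u IH] c /=; first by apply: ReflectT.
apply: (iffP and3P) => [[xS /eqP x0 /IH uP] [|i] ltiu|uP] /=.
- by rewrite addbF.
- by have := uP i ltiu; rewrite addNb addbN.
- have [xS x0] := uP 0%N isT; split; first by rewrite /= addbF in xS.
    exact/eqP.
  by apply/IH => i ltiu; have := uP i.+1 ltiu; rewrite /= addbN addNb.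
Qed.

Lemma free_subalgebrasP :
  free_subalgebras A B <->
  forall c u, (0 < size u)%N -> alternating_centered c u -> moment u = 0.
Proof.
split=> [frAB c u u_gt0 /alternating_centered_nthP uP | fr n u c n_gt0 u0 uS cP].
  apply: (frAB _ (in_tuple u) (fun i => c (+) odd i)) => // [j|j|j _] /=.
  - by rewrite (tnth_nth 0); case: (uP j).
  - by rewrite (tnth_nth 0); case: (uP j).
  - by rewrite addbN -addNb; case: (c) (odd j) => [] [].
apply: (fr (c 0%N)); rewrite ?size_tuple //.
have cE j : (j < n)%N -> c j = c 0%N (+) odd j.
  elim: j => [|j IH] ltjn; first by rewrite addbF.
  by have := cP j ltjn; rewrite (IH (ltnW ltjn)) /=; case: (c _) (odd _) (c _) => [] [] [].
apply/alternating_centered_nthP => i; rewrite size_tuple => ltin.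
have := uS (Ordinal ltin); have := u0 (Ordinal ltin).
by rewrite !(tnth_nth 0) /= cE.
Qed.

Lemma subalg_colour c : GRing.subalg_closed (S c).
Proof. by case: c. Qed.

Lemma center_colour c x : x \in S c -> center x \in S c.
Proof.
have [S1 SL _] := subalg_colour c => xS.
by rewrite /center addrC -scaleNr SL.
Qed.

(* The parity condition says that the last letter has colour [d]. *)
Inductive centered_span d : M -> Prop :=
| CenteredWord c u : (0 < size u)%N -> alternating_centered c u ->
    c (+) odd (size u) = ~~ d -> centered_span d (\prod_(x <- u) x)
| CenteredLinear k x y : centered_span d x -> centered_span d y ->
    centered_span d (k *: x + y).

Lemma centered_span_cons d c x u : x \in S c -> phi x = 0 ->
    alternating_centered (~~ c) u -> c (+) odd (size u) = d ->
  centered_span d (x * \prod_(y <- u) y).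
Proof.
move=> xS x0 uA cd; have := @CenteredWord d c (x :: u).
by rewrite big_cons /= xS x0 eqxx uA addbN cd; apply.
Qed.

Lemma centered_span1 d x : x \in S d -> phi x = 0 -> centered_span d x.
Proof.
move=> xS x0; have := @centered_span_cons d d x [::] xS x0 isT (addbF d).
by rewrite big_nil mulr1.
Qed.

Lemma mul_centerK x y : x * y = phi x *: y + center x * y.
Proof. by rewrite -{1}(centerK x) mulrDl -scalerAl mul1r addrC. Qed.

(** A scalar splits off only when [a] meets a one-letter word of its own colour, which is then [d];
    otherwise the last letter survives. *)
Lemma centered_span_mul d e a v : a \in S e -> centered_span d v ->
  exists2 k, centered_span d (a * v - k *: 1) & e != d -> k = 0.
Proof.
move=> aS; elim=> [c [//|x u] _ /= /and3P[xS x0 uA] cd | k x y _ IHx _ IHy].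
  have [ec|ec] := eqVneq e c; last first.
    (* The colours differ: the mean of [a] rescales the word and its center is prepended. *)
    exists 0 => //; rewrite scale0r subr0 mul_centerK.
    have {}ec : c = ~~ e by case: (c) (e) ec => [] [].
    apply: CenteredLinear; first by apply: (@CenteredWord d c); rewrite //= xS x0.
    apply: (@centered_span_cons d e); rewrite ?center_colour ?phi_center //=.
      by rewrite -ec xS x0.
    by apply: negb_inj; rewrite -cd ec addNb.
  rewrite {}ec in aS *.
  have axS : center (a * x) \in S c.
    by have [_ _ SM] := subalg_colour c; apply: center_colour; apply: SM.
  case: u uA cd => [|y u] uA cd.
    exists (phi (a * x)).
      have -> : d = c by case: (c) (d) cd => [] [].
      by rewrite big_seq1; apply: centered_span1 => //; rewrite phi_center.
    by case: (c) (d) cd => [] [].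
  (* The mean of [a * x] multiplies the shorter word [y :: u], which still ends in colour [d]. *)
  exists 0 => //; rewrite scale0r subr0 big_cons mulrA mul_centerK.
  apply: CenteredLinear.
    apply: (@CenteredWord d (~~ c)) => //; rewrite addNb -addbN //.
  apply: (@centered_span_cons d c) => //; first by rewrite phi_center.
  by apply: negb_inj; rewrite -cd addbN.
have [kx Vx kx0] := IHx; have [ky Vy ky0] := IHy.
exists (k * kx + ky); last by move=> ed; rewrite kx0 // ky0 // mulr0 addr0.
have -> : a * (k *: x + y) - (k * kx + ky) *: 1 =
    k *: (a * x - kx *: 1) + (a * y - ky *: 1).
  by rewrite mulrDr -scalerAr scalerDl opprD addrACA scalerBr scalerA.
exact: CenteredLinear.
Qed.

Hypothesis frAB : free_subalgebras A B.

Lemma phi_centered_span d v : centered_span d v -> phi v = 0.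
Proof.
elim=> [c u u_gt0 uA _ | k x y _ x0 _ y0]; last by rewrite linearP x0 y0 mulr0 addr0.
by have /free_subalgebrasP := frAB; apply; first exact: u_gt0; exact: uA.
Qed.

Lemma centered_fold_span d s a :
  {in s, forall x, exists e, x \in S e} -> a \in S d ->
  centered_span d (centered_fold (rcons s a)).
Proof.
move=> + aS; elim: s => [_ | x s IH sS] /=.
  by rewrite mulr1; apply: centered_span1; rewrite ?center_colour ?phi_center.
have [e xS] := sS x (mem_head _ _).
have Vs : centered_span d (centered_fold (rcons s a)).
  by apply: IH => y ys; apply: sS; rewrite in_cons ys orbT.
have [k Vxs _] := centered_span_mul _ _ _ _ xS Vs.
(* By freeness [phi] vanishes on the span, so [k] must be the mean of the product, and subtracting
   it is exactly [center]. *)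
have := phi_centered_span _ _ Vxs.
rewrite linearB linearZ /= phi1 mulr1 => /subr0_eq phik.
by rewrite /center phik.
Qed.

(** The first letter has the colour opposite to [d], so no scalar splits off and [phi] vanishes on
    the product. *)
Lemma free_boolean_cumulant0 d s a b :
  {in s, forall x, exists e, x \in S e} -> a \in S (~~ d) -> b \in S d ->
  boolean_cumulant (a :: rcons s b) = 0.
Proof.
move=> sS aS bS; rewrite boolean_cumulant_cons.
have [k V k0] := centered_span_mul _ _ _ _ aS (centered_fold_span _ _ _ sS bS).
have := phi_centered_span _ _ V; rewrite k0 ?scale0r ?subr0 //.
by case: (d).
Qed.

End Freeness.

Lemma boolean_cumulant0_free (R : realType) (M : ncProbSpace R)
    (A B : {pred M}) :
  tracial M -> GRing.subalg_closed A -> GRing.subalg_closed B ->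
  (forall d s a b, {in s, forall x, (x \in A) || (x \in B)} ->
     a \in (if ~~ d then A else B) -> b \in (if d then A else B) ->
     boolean_cumulant (a :: rcons s b) = 0) ->
  free_subalgebras A B.
Proof.
move=> trM algA algB bc0; apply/free_subalgebrasP => c u.
have [n] := ubnP (size u); elim: n u c => // n IH u c leun u_gt0 uA.
case: u => [//|x s] in leun u_gt0 uA *.
case/lastP: s => [|s y] in leun u_gt0 uA *.
  by move: uA => /= /and3P[_ /eqP x0 _]; rewrite /moment big_seq1.
move: (uA); rewrite /= => /and3P[xS _].
rewrite -cats1 alternating_centered_cat /= andbT => /and3P[sA yS _].
rewrite /= size_rcons in leun.
have [s_odd|s_even] := boolP (odd (size s)).
  (* Here [x] and [y] share the colour [c]: traciality moves [y] to the front, where it merges with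
     [x]. *)
  rewrite s_odd addNb addbT negbK in yS.
  rewrite /moment cats1 big_cons -cats1 big_cat big_seq1 /= mulrA trM mulrA.
  have yxS : y * x \in (if c then A else B).
    by have [_ _ SM] := subalg_colour _ _ algA algB c; apply: SM.
  have := IH (center (y * x) :: s) c; rewrite /moment big_cons => IHyx.
  rewrite phi_mull_center IHyx //=; first last.
  - by rewrite phi_center eqxx sA center_colour.
  (* The mean of [y * x] multiplies the moment of [s], a shorter word, nonempty because its length
     is odd. *)
  rewrite add0r [X in _ * X](IH s (~~ c)) ?mulr0 //; first exact: ltnW.
  by case: (s) s_odd.
(* For even [s] the end colours differ, so the last term of the recursion, the cumulant of the whole
   word, vanishes. *)
rewrite cats1 boolean_cumulantE // big_nat_recr //= take_size drop_size.
rewrite (bc0 (~~ c)) ?mul0r ?addr0; first last.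
- by rewrite (negbTE s_even) addbF in yS.
- by rewrite negbK.
- move=> z /(nthP 0) [i ltis <-].
  have [+ _] := alternating_centered_nthP _ _ _ _ sA i ltis.
  by case: (_ (+) _) => ->; rewrite ?orbT.
(* In the other terms the tail is a shorter nonempty alternating centered word, so its moment
   vanishes by induction. *)
rewrite big_nat_cond big1 // => k /andP[/andP[k_gt0 ltk] _].
rewrite [moment _](IH _ (c (+) odd k)) ?mulr0 //.
- rewrite size_drop; apply: leq_ltn_trans (leq_sub2l _ k_gt0) _.
  by rewrite subn1 /= size_rcons.
- by rewrite size_drop subn_gt0.
- have := uA; rewrite -[X in alternating_centered _ _ _ X](cat_take_drop k).
  by rewrite alternating_centered_cat => /andP[_]; rewrite size_takel // ltnW.
Qed.

Theorem theorem1p1 (R : realType) (M : ncProbSpace R) (A B : {pred M})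
    (trM : tracial M)
    (algA : GRing.subalg_closed A) (algB : GRing.subalg_closed B) :
  free_subalgebras A B <->
  (forall (n : nat) (a : n.-tuple M),
     (1 < n)%N ->
     (forall i : 'I_n, (tnth a i \in A) || (tnth a i \in B)) ->
     (a`_0 \in A /\ a`_n.-1 \in B) \/ (a`_0 \in B /\ a`_n.-1 \in A) ->
     boolean_cumulant a = 0).
Proof.
split=> [frAB n a n_gt1 aAB ends | bc0].
  have size_a := size_tuple a.
  have {}aAB x : x \in tval a -> exists e : bool, x \in (if e then A else B).
    case/tnthP => i ->; have /orP[xA|xB] := aAB i; [by exists true|by exists false].
  case: (tval a) size_a aAB ends => [|x s]; first by case: n n_gt1 {a}.
  case/lastP: s => [|s y] /= size_a aAB; first by case: n n_gt1 size_a {a} => [|[]].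
  rewrite -size_a /= size_rcons /= nth_rcons ltnn eqxx => ends.
  have sAB : {in s, forall z, exists e : bool, z \in (if e then A else B)}.
    by move=> z zs; apply: aAB; rewrite inE mem_rcons inE zs !orbT.
  (* The boolean passed below is the colour of the last letter. *)
  case: ends => [] [xS yS].
    exact: (free_boolean_cumulant0 _ _ algA algB frAB false).
  exact: (free_boolean_cumulant0 _ _ algA algB frAB true).
apply: boolean_cumulant0_free => // d s x y sAB xS yS.
apply: (bc0 _ (in_tuple (x :: rcons s y))).
- by rewrite /= size_rcons.
- move=> i; have := mem_tnth i (in_tuple (x :: rcons s y)).
  rewrite inE mem_rcons inE => /or3P[/eqP->|/eqP->|/sAB//].
    by move: xS; case: (d) => ->; rewrite ?orbT.
  by move: yS; case: (d) => ->; rewrite ?orbT.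
rewrite /= size_rcons /= nth_rcons ltnn eqxx.
by case: d xS yS; [right|left].
Qed.
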